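(* Let $d\ge2$, let $X$ be a normal complex $d\times d$ matrix, let $\rho$ be a $d\times d$ density matrix, and let $|||\cdot|||$ be any unitarily invariant norm on the complex $d\times d$ matrices. With $F=\mathrm{Diag}(1,1,0,\dots,0)$, $$\sqrt{\mathrm{Var}(X)} \le r(X) \le \tfrac12\|X\|_{(2)} \le \frac{|||X|||}{|||F|||},$$ where $\mathrm{Var}(X)$ is the quantum variance of $X$ with respect to $\rho$. For example, taking $|||\cdot|||$ to be the Schatten $p$-norm ($p\ge1$), the right-hand side is $2^{-1/p}\|X\|_p$.
   Context: A density matrix is a positive semidefinite matrix of trace 1. The quantum variance of a normal matrix $X$ with respect to $\rho$ is $\mathrm{Var}(X)=\mathrm{Tr}[\rho|X|^2]-|\mathrm{Tr}[\rho X]|^2$, with $|X|=(X^*X)^{1/2}$. The radius $r(X)$ of a normal matrix is the radius of the smallest circle in the complex plane enclosing its spectrum, i.e. $r(X)=\min_{y\in\mathbb{C}}\max_i|\lambda_i-y|$ with $\lambda_i$ the eigenvalues of $X$. With $\sigma_1(X)\ge\sigma_2(X)\ge\dots$ the singular values of $X$, $\|X\|_{(2)}=\sigma_1(X)+\sigma_2(X)$ is the second Ky Fan norm and $\|X\|_p=(\sum_i\sigma_i(X)^p)^{1/p}$ the Schatten $p$-norm. *)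

(* Defs.v *)
From HB Require Import structures.
From mathcomp Require Export all_boot all_order all_algebra.
From mathcomp Require Export sesquilinear spectral.
From mathcomp Require Export complex.
From mathcomp Require Export boolp classical_sets reals exp.

Set Implicit Arguments.
Unset Strict Implicit.
Unset Printing Implicit Defensive.

Import Order.TTheory GRing.Theory Num.Theory.

Local Open Scope classical_set_scope.
Local Open Scope complex_scope.
Local Open Scope sesquilinear_scope.
Local Open Scope ring_scope.

Section QuantumVariance.
Context {R : realType} {d : nat}.
Local Notation C := R[i].
Implicit Types (A X rho : 'M[C]_d).

(* [0 <= z] in [R[i]] means that [z] is real and nonnegative. *)
Definition psdmx A : Prop :=
  A \is hermsymmx /\ forall v : 'cV[C]_d, 0 <= (v^t* *m A *m v) 0 0.

Definition density_matrix rho : Prop := psdmx rho /\ \tr rho = 1.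

(* The positive square root, meaningful for positive semidefinite [A]. *)
Definition sqrtmx A : 'M[C]_d :=
  invmx (spectralmx A) *m diag_mx (map_mx sqrtC (spectral_diag A))
    *m spectralmx A.

Definition absmx X : 'M[C]_d := sqrtmx (X^t* *m X).

(* Kept in [R[i]]: that the variance is real is not built into its type. *)
Definition qvar rho X : C :=
  \tr (rho *m (absmx X *m absmx X)) - `| \tr (rho *m X) | ^+ 2.

(* min_y max_i |lambda_i - y|. The spectrum is finite, and nonempty for       *)
(* [0 < d], so the supremum is a maximum; the infimum is attained, since its  *)
(* objective is continuous in y and tends to infinity with |y|.               *)
Definition mxradius X : R :=
  inf [set sup [set Normc.normc (a - y) | a in [set a : C | eigenvalue X a]]
      | y in [set: C]].

(* [sigma_1 >= ... >= sigma_d] with multiplicity; the eigenvalues of [X^* X]  *)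
(* are real and nonnegative, so [Re] is only a cast.                          *)
Definition singular_values X : seq R :=
  sort >=%R [seq Num.sqrt (complex.Re (spectral_diag (X^t* *m X) 0 i))
            | i <- enum 'I_d].

Definition kyfan2 X : R := (singular_values X)`_0 + (singular_values X)`_1.

Definition schatten (p : R) X : R :=
  (\sum_(s <- singular_values X) s `^ p) `^ p^-1.

Record unitarily_invariant_norm (N : 'M[C]_d -> R) : Prop := {
  uinorm_ge0 : forall A, 0 <= N A;
  uinorm_eq0 : forall A, N A = 0 -> A = 0;
  uinormZ : forall (c : C) A, N (c *: A) = Normc.normc c * N A;
  uinormD : forall A B, N (A + B) <= N A + N B;
  uinorm_unitary : forall U A V, U \is unitarymx -> V \is unitarymx ->
    N (U *m A *m V) = N A
}.

End QuantumVariance.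

(* Main.v *)
From mathcomp Require Import all_fingroup ring lra.
Require Import Defs.
Import Order.TTheory GRing.Theory Num.Theory.
Local Open Scope classical_set_scope.
Local Open Scope complex_scope.
Local Open Scope sesquilinear_scope.
Local Open Scope ring_scope.

Set Implicit Arguments.
Unset Strict Implicit.
Unset Printing Implicit Defensive.

(** Everything reduces to diagonal matrices. In an orthonormal eigenbasis of
    [X], with eigenvalues [z i], the diagonal of [rho] is a probability vector
    [p], and the quantum variance is the variance of [z] under [p]. A variance
    is invariant under translation ([variance_shift]), so for every centre [y]
    it is at most the mean of [|z i - y|^2], hence at most the squared radius
    of any disc that contains the spectrum ([sqrt_qvar_le_mxradius]).

    The singular values of a normal matrix are the moduli of its eigenvalues.
    One eigenvalue has modulus [s0], the others have modulus at most [s1], and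
    an explicit disc of radius [(s0 + s1) / 2] contains them all
    ([mxradius_le_kyfan2]).

    For a unitarily invariant norm, the singular value decomposition makes the
    matrix diagonal; averaging its images under sign flips and under the
    exchange of the two largest singular values produces
    [(s0 + s1) / 2] times [Diag(1,1,0,...,0)], and averaging does not increase
    the norm ([kyfan2_le_uinorm]).

    That the Schatten functional is a norm is clear from the singular value
    decomposition except for the triangle inequality ([schattenD]). It follows
    from the variational bound [diag_le_singular_values]: whatever the two
    orthonormal bases, the diagonal entries of a matrix have an [l^p] norm at
    most the Schatten norm, with equality in the singular bases. The latter
    bound is the inequality of Jensen for a doubly stochastic matrix.

    The singular value decomposition itself is derived from the spectral
    theorem for the Gram matrix and from the completion of orthonormal
    families ([svd_diag]); uniqueness of singular values
    ([singular_values_diag]) comes from characteristic polynomials. *)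

(** * Unitary matrices and the singular value decomposition *)

Section Unitary.
Context {C : numClosedFieldType}.
Implicit Types n : nat.

Lemma trmxC_mul m n p (A : 'M[C]_(m, n)) (B : 'M[C]_(n, p)) :
  (A *m B)^t* = B^t* *m A^t*.
Proof. by rewrite trmx_mul map_mxM. Qed.

Lemma trmxC_diag n (v : 'rV[C]_n) :
  (diag_mx v)^t* = diag_mx (\row_i (v 0 i)^*).
Proof.
by rewrite tr_diag_mx map_diag_mx; congr diag_mx; apply/rowP=> i; rewrite !mxE.
Qed.

Lemma unitary_mulmxtV n (U : 'M[C]_n) : U \is unitarymx -> U *m U^t* = 1%:M.
Proof. by move/unitarymxP. Qed.

Lemma unitary_mulmxVt n (U : 'M[C]_n) : U \is unitarymx -> U^t* *m U = 1%:M.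
Proof. by rewrite -trmxC_unitary => /unitarymxP; rewrite trmxCK. Qed.

Lemma unitary_trmxC n (U : 'M[C]_n) : U \is unitarymx -> U^t* \is unitarymx.
Proof. by rewrite trmxC_unitary. Qed.

Lemma unitarymx1 n : (1%:M : 'M[C]_n) \is unitarymx.
Proof. by apply/unitarymxP; rewrite trmx1 map_mx1 mulmx1. Qed.

Lemma unitary_cancel n (U D V : 'M[C]_n) : U \is unitarymx -> V \is unitarymx ->
  U^t* *m (U *m D *m V) *m V^t* = D.
Proof.
move=> uU uV; rewrite !mulmxA unitary_mulmxVt // mul1mx.
by rewrite -mulmxA unitary_mulmxtV // mulmx1.
Qed.

Lemma perm_mx_unitary n (s : 'S_n) : perm_mx s \is @unitarymx C n n.
Proof.
apply/unitarymxP; rewrite tr_perm_mx map_perm_mx -perm_mxM mulgV.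
exact: perm_mx1.
Qed.

Lemma diag_mx_perm n (s : 'S_n) (v : 'rV[C]_n) :
  diag_mx (\row_i v 0 (s i)) = perm_mx s *m diag_mx v *m perm_mx s^-1.
Proof.
rewrite -row_permE -col_permE; apply/matrixP=> i j.
by rewrite !mxE (inj_eq (@perm_inj _ s)).
Qed.

Lemma diag_mx_unitary n (v : 'rV[C]_n) :
  (forall i, `|v 0 i| = 1) -> diag_mx v \is unitarymx.
Proof.
move=> v1; apply/unitarymxP; rewrite trmxC_diag mulmx_diag.
apply/matrixP=> i j; rewrite !mxE.
by case: eqP => // _; rewrite -normCK v1 expr1n.
Qed.

Lemma char_poly_conj n (P A : 'M[C]_n) : P \in unitmx ->
  char_poly (invmx P *m A *m P) = char_poly A.
Proof.
move=> uP; rewrite /char_poly /char_poly_mx !map_mxM.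
set Q := map_mx _ (invmx P); set P' := map_mx _ P.
have QP : Q *m P' = 1%:M by rewrite -map_mxM mulVmx // map_mx1.
have XE : 'X%:M = Q *m 'X%:M *m P' by rewrite scalar_mxC -mulmxA QP mulmx1.
rewrite [in LHS]XE -mulmxBl -mulmxBr !det_mulmx mulrAC -det_mulmx.
by rewrite QP det1 mul1r.
Qed.

Lemma char_poly_diag n (v : 'rV[C]_n) :
  char_poly (diag_mx v) = \prod_i ('X - (v 0 i)%:P).
Proof.
rewrite char_poly_trig ?diag_mx_is_trig //.
by apply: eq_bigr => i _; rewrite mxE eqxx.
Qed.

(** A diagonal form is determined up to order: both diagonals list, with
    multiplicity, the roots of the same characteristic polynomial. *)
Lemma spectrum_uniq n (P Q : 'M[C]_n) (v w : 'rV[C]_n) :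
    P \is unitarymx -> Q \is unitarymx ->
    P^t* *m diag_mx v *m P = Q^t* *m diag_mx w *m Q ->
  perm_eq [seq v 0 i | i <- enum 'I_n] [seq w 0 i | i <- enum 'I_n].
Proof.
move=> uP uQ /(congr1 (@char_poly C n)).
rewrite -!invmx_unitary // !char_poly_conj ?unitarymx_unit // !char_poly_diag.
by move=> e; apply: prod_XsubC_eq; rewrite !big_map -!enumT !big_enum.
Qed.

Lemma row_mul_trmxC n (B : 'M[C]_n) i j :
  (B *m B^t*) i j = (row i B *m (row j B)^t*) 0 0.
Proof. by rewrite !mxE; apply: eq_bigr => k _; rewrite !mxE. Qed.

(** Completion to an orthonormal basis that leaves the rows indexed by [S] in
    place. Since some index is outside [S], the rows in [S] do not span, so a
    unit vector orthogonal to them exists; it becomes one more row, and the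
    complement of [S] shrinks. *)
Lemma orthonormal_rows_complete n (B : 'M[C]_n) (S : {set 'I_n}) :
    {in S &, forall i j, (B *m B^t*) i j = (i == j)%:R} ->
  exists2 W : 'M[C]_n, W \is unitarymx & {in S, forall i, row i W = row i B}.
Proof.
have [m] := ubnP #|~: S|; elim: m => // m IHm in B S *.
rewrite ltnS => cardS orthoB.
have [/eqP S0|/set0Pn[k]] := boolP (~: S == finset.set0).
  exists B => //; apply/unitarymxP/matrixP => i j; rewrite !orthoB ?mxE //;
  by rewrite -(finset.setCK S) S0 finset.setC0 finset.inE.
rewrite finset.inE => kS.
(* Blanking the rows outside S makes B singular; a kernel vector of the
   adjoint is orthogonal to all the rows indexed by S. *)
pose e : 'rV[C]_n := \row_i (i \in S)%:R.
have /eqP/det0P[v v0 vB] : \det (B^t* *m diag_mx e) = 0.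
  by rewrite det_mulmx det_diag (bigD1 k) //= mxE (negPf kS) mul0r mulr0.
have {}vB i : i \in S -> (v *m (row i B)^t*) 0 0 = 0.
  move=> iS; move/rowP/(_ i): vB; rewrite mulmxA mul_mx_diag !mxE iS mulr1 => vB0.
  by rewrite -[RHS]vB0; apply: eq_bigr => j _; rewrite !mxE.
have := dotmx_is_dotmx v0; rewrite dotmxE => q_gt0.
set q := (v *m v^t*) 0 0 in q_gt0.
pose u := (sqrtC q)^-1 *: v.
have uu : (u *m u^t*) 0 0 = 1.
  have q1 : (sqrtC q)^* = sqrtC q by apply/CrealP/ger0_real; rewrite sqrtC_ge0 ltW.
  rewrite /u linearZ /= map_mxZ -scalemxAl -scalemxAr !mxE -/q fmorphV.
  have -> : \sum_j v 0 j * (v^t*) j 0 = q by rewrite /q mxE.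
  rewrite /= q1 mulrA -invfM -expr2 sqrtCK mulVf // gt_eqF //.
have uB i : i \in S -> (u *m (row i B)^t*) 0 0 = 0.
  by move=> iS; rewrite -scalemxAl mxE vB // mulr0.
have Bu i : i \in S -> (row i B *m u^t*) 0 0 = 0.
  move=> iS; have /(congr1 Num.conj) := uB i iS; rewrite rmorph0 => <-.
  rewrite -[row i B in LHS]trmxCK -trmxC_mul.
  by rewrite mxE mxE.
pose B' : 'M[C]_n := \matrix_i if i == k then u else row i B.
have [||W uW WB] := IHm B' (k |: S).
- apply: leq_trans cardS; apply: proper_card; apply/properP; split.
    by rewrite finset.setCS finset.subsetUr.
  by exists k; rewrite !finset.inE ?eqxx.
- move=> i j; rewrite !finset.inE row_mul_trmxC !rowK.
  case: (eqVneq i k) => [->|ik] /=; case: (eqVneq j k) => [->|jk] //=.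
  + by move=> _ jS; rewrite uB.
  + by move=> iS _; rewrite Bu // (negPf ik).
  + by move=> iS jS; rewrite -row_mul_trmxC orthoB.
exists W => // i iS; rewrite WB ?rowK; last by rewrite !finset.inE iS orbT.
by case: eqP => // ik; rewrite ik (negPf kS) in iS.
Qed.

Lemma normalmx_gram n (X : 'M[C]_n) : X^t* *m X \is normalmx.
Proof. by apply/normalmxP; rewrite trmxC_mul trmxCK. Qed.

Lemma normal_diagonalization n (X : 'M[C]_n) : X \is normalmx ->
  exists2 P, P \is unitarymx &
    X = P^t* *m diag_mx (spectral_diag X) *m P.
Proof.
move/orthomx_spectralP=> XE; have uP := spectral_unitarymx X.
by exists (spectralmx X) => //; rewrite -invmx_unitary.
Qed.

Lemma gram_diag n (U V : 'M[C]_n) (a : 'rV[C]_n) : U \is unitarymx ->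
  (U *m diag_mx a *m V)^t* *m (U *m diag_mx a *m V) =
  V^t* *m diag_mx (\row_i ((a 0 i)^* * a 0 i)) *m V.
Proof.
move=> uU; rewrite !trmxC_mul !mulmxA -[_ *m U^t* *m U]mulmxA.
rewrite unitary_mulmxVt // mulmx1 -[V^t* *m _ *m diag_mx a]mulmxA.
rewrite trmxC_diag mulmx_diag; congr (_ *m diag_mx _ *m _).
by apply/rowP => i; rewrite !mxE.
Qed.

Lemma mulmx_trmxC_diag_ge0 n (B : 'M[C]_n) i : 0 <= (B *m B^t*) i i.
Proof. by rewrite mxE sumr_ge0 // => k _; rewrite !mxE -normCK exprn_ge0. Qed.

(** Polar-type factorization: the nonzero rows, once normalized, are
    orthonormal, and any orthonormal completion supplies the directions of the
    rows that vanish. *)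
Lemma orthogonal_rows_factor n (B : 'M[C]_n) (D : 'rV[C]_n) :
    B *m B^t* = diag_mx D ->
  exists2 W, W \is unitarymx & B = diag_mx (map_mx sqrtC D) *m W.
Proof.
move=> BB.
have D_ge0 i : 0 <= D 0 i.
  by have := mulmx_trmxC_diag_ge0 B i; rewrite BB mxE eqxx.
have sC i : (sqrtC (D 0 i))^* = sqrtC (D 0 i).
  by apply/CrealP/ger0_real; rewrite sqrtC_ge0.
pose S := [set i | D 0 i != 0]%SET.
pose e : 'rV[C]_n := \row_i (sqrtC (D 0 i))^-1.
have [i j|W uW WB] := @orthonormal_rows_complete _ (diag_mx e *m B) S.
  rewrite !finset.inE => Di _.
  rewrite trmxC_mul mulmxA -[_ *m B *m _]mulmxA BB trmxC_diag !mulmx_diag.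
  rewrite !mxE; case: (eqVneq i j) => [_|//].
  by rewrite mulr1n fmorphV /= sC mulrAC -invfM -expr2 sqrtCK mulVf.
exists W => //; apply/row_matrixP => i.
rewrite row_mul row_diag_mx -scalemxAl -rowE mxE.
have [Di|Di] := eqVneq (D 0 i) 0; last first.
  rewrite WB ?finset.inE // row_mul row_diag_mx -scalemxAl -rowE mxE scalerA.
  by rewrite mulfV ?scale1r // sqrtC_eq0.
rewrite Di sqrtC0 scale0r; apply/eqP/negPn/negP => /dotmx_is_dotmx.
by rewrite dotmxE -row_mul_trmxC BB mxE eqxx Di ltxx.
Qed.

(** Singular value decomposition. If [P] diagonalizes the Gram matrix of [X],
    the rows of [P *m X^t*] are orthogonal and their squared lengths are the
    eigenvalues of that Gram matrix. *)
Lemma svd_diag n (X : 'M[C]_n) : exists U V (a : 'rV[C]_n),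
  [/\ U \is unitarymx, V \is unitarymx, forall i, 0 <= a 0 i
    & X = U *m diag_mx a *m V].
Proof.
have [P uP] := normal_diagonalization (normalmx_gram X).
set D := spectral_diag _ => gramE.
have BB : (P *m X^t*) *m (P *m X^t*)^t* = diag_mx D.
  rewrite trmxC_mul trmxCK -mulmxA [_ *m (X *m _)]mulmxA gramE.
  by rewrite !mulmxA unitary_mulmxtV // mul1mx mulmxtVK.
have [W uW BE] := orthogonal_rows_factor BB.
have sD i : 0 <= sqrtC (D 0 i).
  by rewrite sqrtC_ge0; have := mulmx_trmxC_diag_ge0 (P *m X^t*) i;
    rewrite BB mxE eqxx.
exists (W^t*), P, (map_mx sqrtC D); split=> //; rewrite ?trmxC_unitary //.
  by move=> i; rewrite mxE.
have := congr1 (fun A => (P^t* *m A)^t*) BE; rewrite mulmxA unitary_mulmxVt //.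
rewrite mul1mx trmxCK => ->; rewrite !trmxC_mul trmxCK trmxC_diag.
congr (_ *m diag_mx _ *m _); apply/rowP => i; rewrite !mxE.
by apply/CrealP/ger0_real.
Qed.

Lemma mulmx_diag_perm n (U V : 'M[C]_n) (t : 'S_n) (a : 'rV[C]_n) :
  U *m diag_mx a *m V =
  (U *m (perm_mx t)^t*) *m diag_mx (\row_i a 0 (t i)) *m (perm_mx t *m V).
Proof.
have uQ := perm_mx_unitary t.
have QV : perm_mx t^-1 = (perm_mx t)^t* :> 'M[C]_n by rewrite tr_perm_mx map_perm_mx.
rewrite diag_mx_perm QV !mulmxA.
do 2 rewrite -[_ *m (perm_mx t)^t* *m perm_mx t]mulmxA unitary_mulmxVt // mulmx1.
by [].
Qed.

End Unitary.

(** * Singular values *)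

Section SingularValues.
Context {R : realType} {d : nat}.
Local Notation C := R[i].
Local Notation normc := (@Normc.normc R).
Implicit Types (X U V : 'M[C]_d) (a : 'rV[C]_d).

Lemma norm_normc (z : C) : `|z| = (normc z)%:C.
Proof. by case: z. Qed.

Lemma normc_ge0 (z : C) : 0 <= normc z.
Proof. by case: z => x y; apply: sqrtr_ge0. Qed.

Lemma normc_real (x : R) : 0 <= x -> normc x%:C = x.
Proof. by move=> x0; rewrite /= expr0n addr0 sqrtr_sqr ger0_norm. Qed.

Lemma sqrt_Re_mulJ (z : C) : Num.sqrt (complex.Re (z^* * z)) = normc z.
Proof.
by rewrite mulrC -normCK norm_normc -rmorphXn /= sqrtr_sqr ger0_norm ?normc_ge0.
Qed.

(** This frees the singular values from the particular spectral decomposition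
    used to define them: any factorization of [X] through unitaries and a
    diagonal, of arbitrary phases and order, exhibits them. For a normal matrix
    they are the moduli of the eigenvalues. *)
Lemma singular_values_diag X U V a :
    U \is unitarymx -> V \is unitarymx -> X = U *m diag_mx a *m V ->
  singular_values X = sort >=%R [seq normc (a 0 i) | i <- enum 'I_d].
Proof.
move=> uU uV XE; rewrite /singular_values.
apply/perm_sortP.
- by move=> x y; apply: le_total.
- by move=> y x z /= yx zy; apply: le_trans zy yx.
- by move=> x y /= /le_anti.
have [P uP] := normal_diagonalization (normalmx_gram X).
have := gram_diag V a uU; rewrite -XE => -> /esym/(spectrum_uniq uP uV).
move/(perm_map (fun z => Num.sqrt (complex.Re z))); rewrite -!map_comp.
by under [X in perm_eq _ X]eq_map do rewrite /= mxE sqrt_Re_mulJ.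
Qed.

Lemma size_singular_values X : size (singular_values X) = d.
Proof. by rewrite size_sort size_map size_enum_ord. Qed.

Lemma sort_enumP (f : 'I_d -> R) :
  exists s : 'S_d, forall i : 'I_d,
    (sort >=%R [seq f i | i <- enum 'I_d])`_i = f (s i).
Proof.
have /tuple_permP[s sE] :
    perm_eq (sort >=%R [seq f i | i <- enum 'I_d]) [tuple f i | i < d].
  by rewrite perm_sort.
exists s => i; rewrite sE.
by rewrite (nth_map i) ?size_enum_ord // nth_ord_enum tnth_mktuple.
Qed.

Lemma svd X : exists U V, [/\ U \is unitarymx, V \is unitarymx
  & X = U *m diag_mx (\row_i ((singular_values X)`_i)%:C) *m V].
Proof.
have [U [V [a [uU uV a_ge0 XE]]]] := svd_diag X.
have [t tE] := sort_enumP (fun i => normc (a 0 i)).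
rewrite (singular_values_diag uU uV XE).
exists (U *m (perm_mx t)^t*), (perm_mx t *m V); split.
- by rewrite mul_unitarymx ?trmxC_unitary ?perm_mx_unitary.
- by rewrite mul_unitarymx ?perm_mx_unitary.
rewrite {1}XE (mulmx_diag_perm U V t a); congr (_ *m diag_mx _ *m _).
by apply/rowP => i; rewrite !mxE tE -norm_normc ger0_norm.
Qed.

End SingularValues.

(** * Power means: Jensen and Minkowski *)

Section PowerMeans.
Context {R : realType}.
Implicit Types (p c x e : R) (I : finType).

(** The power function lies above its tangent at [c]. This is the inequality of
    Young applied to [x] and [c `^ (p - 1)], with the exponent [p / (p - 1)]
    conjugate to [p]; the case [p = 1] is an equality. *)
Lemma powR_tangent p c x : 1 <= p -> 0 <= c -> 0 <= x ->
  c `^ p + p * c `^ (p - 1) * (x - c) <= x `^ p.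
Proof.
move=> p1 c0 x0; have p0 : 0 < p := lt_le_trans ltr01 p1.
have cp : c `^ p = c * c `^ (p - 1).
  rewrite -{2}[c]powRr1 // -powRD; first by rewrite addrC subrK.
  by rewrite addrC subrK gt_eqF.
move: p1; rewrite le_eqVlt => /predU1P[<-|p1].
  by rewrite subrr powRr0 !powRr1 // !mul1r addrC subrK.
have q0 : 0 < p - 1 by rewrite subr_gt0.
have b0 := powR_ge0 c (p - 1); rewrite cp; set b := _ `^ (p - 1) in cp b0 *.
have bq : b `^ (p / (p - 1)) = c * b.
  by rewrite -powRrM mulrCA divff ?mulr1 // gt_eqF.
have pq1 : p^-1 + (p / (p - 1))^-1 = 1 by field; rewrite ?gt_eqF // ?divr_gt0.
have := conjugate_powR x0 b0 p0 (divr_gt0 p0 q0) pq1.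
rewrite bq -(ler_pM2l p0).
have -> : p * (x `^ p / p + c * b / (p / (p - 1))) = x `^ p + (p - 1) * (c * b).
  by field; rewrite ?gt_eqF // ?divr_gt0.
lra.
Qed.

(** Average the tangent inequalities at the mean [c]: the linear terms
    cancel. *)
Lemma powR_jensen I p (w x : I -> R) : 1 <= p ->
    (forall i, 0 <= w i) -> (forall i, 0 <= x i) -> \sum_i w i = 1 ->
  (\sum_i w i * x i) `^ p <= \sum_i w i * x i `^ p.
Proof.
move=> p1 w0 x0 w1; set c := \sum_i w i * x i.
have c0 : 0 <= c by apply: sumr_ge0 => i _; rewrite mulr_ge0.
have -> : c `^ p = \sum_i w i * (c `^ p + p * c `^ (p - 1) * (x i - c)).
  under eq_bigr do rewrite mulrDr mulrCA mulrBr.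
  rewrite big_split /= -mulr_suml w1 mul1r -mulr_sumr sumrB -/c.
  by rewrite -mulr_suml w1 mul1r subrr mulr0 addr0.
by apply: ler_sum => i _; rewrite ler_wpM2l // powR_tangent.
Qed.

Lemma powR_convex p t u x y : 1 <= p -> 0 <= t -> 0 <= u -> t + u = 1 ->
  0 <= x -> 0 <= y -> (t * x + u * y) `^ p <= t * x `^ p + u * y `^ p.
Proof.
move=> p1 t0 u0 tu x0 y0.
have := @powR_jensen bool p (fun b => if b then t else u)
          (fun b => if b then x else y) p1.
by rewrite !big_bool /=; apply=> // -[].
Qed.

(** Convexity of the unit ball: [(x + y) / (a + b)] is the convex combination
    of [x / a] and [y / b] with weights [a / (a + b)] and [b / (a + b)]. *)
Lemma minkowski_strict I p (x y : I -> R) a b : 1 <= p -> 0 < a -> 0 < b ->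
    (forall i, 0 <= x i) -> (forall i, 0 <= y i) ->
    \sum_i x i `^ p <= a `^ p -> \sum_i y i `^ p <= b `^ p ->
  \sum_i (x i + y i) `^ p <= (a + b) `^ p.
Proof.
move=> p1 a0 b0 x0 y0 xa yb; have ab0 : 0 < a + b by apply: addr_gt0.
have tu : a / (a + b) + b / (a + b) = 1 by rewrite -mulrDl divff // gt_eqF.
have step i : (x i + y i) `^ p <= (a + b) `^ p *
    (a / (a + b) * (x i `^ p / a `^ p) + b / (a + b) * (y i `^ p / b `^ p)).
  have -> : x i + y i =
      (a + b) * (a / (a + b) * (x i / a) + b / (a + b) * (y i / b)).
    by field; rewrite !gt_eqF.
  have divp z c : 0 <= z -> 0 < c -> z `^ p / c `^ p = (z / c) `^ p.
    move=> z0 /ltW c0; rewrite powRM ?invr_ge0 //; congr (_ * _).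
    by rewrite -(powR_inv1 c0) -(powR_inv1 (powR_ge0 c p)) powRAC.
  have [/ltW a0' /ltW b0' /ltW ab0'] := And3 a0 b0 ab0.
  rewrite powRM ?addr_ge0 ?mulr_ge0 ?invr_ge0 //.
  rewrite ler_wpM2l ?powR_ge0 // !divp //.
  by apply: powR_convex; rewrite ?divr_ge0.
apply: le_trans (ler_sum _ (fun i _ => step i)) _.
rewrite -mulr_sumr -[leRHS]mulr1 ler_wpM2l ?powR_ge0 // -[leRHS]tu.
rewrite big_split /= -!mulr_sumr -!mulr_suml.
have weight z S c : 0 <= z -> 0 < c -> S <= c `^ p -> z * (S / c `^ p) <= z.
  by move=> z0 c0 Sc; rewrite ler_piMr // ler_pdivrMr ?powR_gt0 // mul1r.
by apply: lerD; apply: weight; rewrite ?divr_ge0 // ltW.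
Qed.

Lemma minkowski_sum I p (x y : I -> R) : 1 <= p ->
    (forall i, 0 <= x i) -> (forall i, 0 <= y i) ->
  (\sum_i (x i + y i) `^ p) `^ p^-1
    <= (\sum_i x i `^ p) `^ p^-1 + (\sum_i y i `^ p) `^ p^-1.
Proof.
move=> p1 x0 y0; have p0 : 0 < p := lt_le_trans ltr01 p1.
have root z : 0 <= z -> (z `^ p^-1) `^ p = z.
  by move=> z0; rewrite -powRrM mulVf ?powRr1 // gt_eqF.
have root' z : 0 <= z -> (z `^ p) `^ p^-1 = z.
  by move=> z0; rewrite -powRrM mulfV ?powRr1 // gt_eqF.
have mono z t q : 0 <= q -> 0 <= z -> z <= t -> z `^ q <= t `^ q.
  by move=> q0 z0 zt; apply: ge0_ler_powR; rewrite ?nnegrE // (le_trans z0).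
set a := (\sum_i x i `^ p) `^ p^-1; set b := (\sum_i y i `^ p) `^ p^-1.
have sum0 (z : I -> R) : 0 <= \sum_i z i `^ p.
  by apply: sumr_ge0 => i _; apply: powR_ge0.
(* Adding e / 2 to both norms makes them positive, so that they can be used as
   the radii a and b above even when x or y vanishes. *)
apply/ler_addgt0Pr => e e0; have e2 : 0 < e / 2 by rewrite divr_gt0.
have [a0 b0] : 0 <= a /\ 0 <= b by split; apply: powR_ge0.
have -> : a + b + e = (a + e / 2) + (b + e / 2) by field.
have ab0 := addr_ge0 (addr_ge0 a0 (ltW e2)) (addr_ge0 b0 (ltW e2)).
rewrite -(root' _ ab0).
apply: (mono); rewrite ?invr_ge0 ?(ltW p0) //.
have up z c : 0 <= z -> c = z `^ p^-1 -> z <= (c + e / 2) `^ p.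
  move=> z0 ->; rewrite -{1}[z]root //; apply: mono; rewrite ?(ltW p0) ?powR_ge0 //.
  by rewrite lerDl ltW.
exact: (minkowski_strict p1 (ltr_wpDl a0 e2) (ltr_wpDl b0 e2) x0 y0
  (up _ _ (sum0 x) erefl) (up _ _ (sum0 y) erefl)).
Qed.

End PowerMeans.

(** * Schatten norms *)

Section SchattenNorm.
Context {R : realType} {d : nat}.
Local Notation C := R[i].
Local Notation normc := (@Normc.normc R).
Implicit Types (X A B U V : 'M[C]_d) (a : 'rV[C]_d) (p : R).

Lemma normc_sum (I : finType) (F : I -> C) :
  normc (\sum_i F i) <= \sum_i normc (F i).
Proof.
rewrite -lecR -norm_normc rmorph_sum /=.
apply: le_trans (ler_norm_sum _ _ _) _.
by apply: ler_sum => i _; rewrite norm_normc.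
Qed.

Lemma unitary_row_normc U i : U \is unitarymx -> \sum_k normc (U i k) ^+ 2 = 1.
Proof.
move=> uU; apply: complexI; rewrite rmorph_sum.
transitivity ((U *m U^t*) i i); last by rewrite unitary_mulmxtV // mxE eqxx.
by rewrite mxE; apply: eq_bigr => k _; rewrite !mxE -normCK norm_normc rmorphXn.
Qed.

Lemma unitary_col_normc U k : U \is unitarymx -> \sum_i normc (U i k) ^+ 2 = 1.
Proof.
rewrite -trmx_unitary => /(unitary_row_normc k) <-.
by apply: eq_bigr => i _; rewrite mxE.
Qed.

Lemma sum_singular_values_diag (f : R -> R) X U V a :
    U \is unitarymx -> V \is unitarymx -> X = U *m diag_mx a *m V ->
  \sum_(s <- singular_values X) f s = \sum_i f (normc (a 0 i)).
Proof.
move=> uU uV /(singular_values_diag uU uV) ->.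
by rewrite (perm_big _ (permEl (perm_sort _ _))) big_map big_enum.
Qed.

Lemma singular_value_ge0 X (i : nat) : 0 <= (singular_values X)`_i.
Proof.
have [lt_i|le_i] := ltnP i (size (singular_values X)); last by rewrite nth_default.
have := mem_nth 0 lt_i; rewrite mem_sort => /mapP[k _ ->]; exact: sqrtr_ge0.
Qed.

(** In any pair of orthonormal bases the diagonal of [A] has a smaller
    [p]-power sum than the singular values. Insert the singular value
    decomposition of [A]: each diagonal entry becomes a sum of
    [M i k * s k * N k i] with [M], [N] unitary, so its modulus is at most the
    mean of [s] for the weights [(|M i k|^2 + |N k i|^2) / 2]. These weights
    form a doubly stochastic matrix, as the rows and columns of a unitary
    matrix have length 1. Convexity bounds the [p]-th powers row by row, and
    the column sums restore the total. *)
Lemma diag_le_singular_values p A U V : 1 <= p ->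
    U \is unitarymx -> V \is unitarymx ->
  \sum_i normc ((U *m A *m V) i i) `^ p <= \sum_(s <- singular_values A) s `^ p.
Proof.
move=> p1 uU uV; have [W [Z [uW uZ AE]]] := svd A.
pose s (k : 'I_d) := (singular_values A)`_k.
have s0 k : 0 <= s k by apply: singular_value_ge0.
rewrite (big_nth 0) size_singular_values big_mkord.
pose M := U *m W; pose N := Z *m V.
have uM : M \is unitarymx := mul_unitarymx uU uW.
have uN : N \is unitarymx := mul_unitarymx uZ uV.
have entry i : (U *m A *m V) i i = \sum_k M i k * (s k)%:C * N k i.
  rewrite AE !mulmxA -/M -mulmxA -/N mul_mx_diag mxE.
  by apply: eq_bigr => k _; rewrite !mxE.
pose w i k := 2^-1 * (normc (M i k) ^+ 2 + normc (N k i) ^+ 2).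
have w0 i k : 0 <= w i k by rewrite mulr_ge0 ?addr_ge0 ?sqr_ge0 // invr_ge0.
have half : 2^-1 * (1 + 1) = 1 :> R by field.
have wrow i : \sum_k w i k = 1.
  rewrite -mulr_sumr big_split /=.
  by rewrite (unitary_row_normc i uM) (unitary_col_normc i uN).
have wcol k : \sum_i w i k = 1.
  rewrite -mulr_sumr big_split /=.
  by rewrite (unitary_row_normc k uN) (unitary_col_normc k uM).
have bound i : normc ((U *m A *m V) i i) <= \sum_k w i k * s k.
  rewrite entry; apply: le_trans (normc_sum _) _; apply: ler_sum => k _.
  rewrite !Normc.normcM normc_real // mulrAC ler_wpM2r // /w.
  have := sqr_ge0 (normc (M i k) - normc (N k i)); lra.
have p0 : 0 <= p := le_trans ler01 p1.
apply: (@le_trans _ _ (\sum_i \sum_k w i k * s k `^ p)).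
  apply: ler_sum => i _; apply: le_trans (powR_jensen p1 (w0 i) s0 (wrow i)).
  apply: ge0_ler_powR; rewrite ?nnegrE ?normc_ge0 //.
  by apply: sumr_ge0 => k _; rewrite mulr_ge0.
rewrite exchange_big /= le_eqVlt; apply/orP; left; apply/eqP.
by apply: eq_bigr => k _; rewrite -mulr_suml wcol mul1r.
Qed.

Lemma schatten_diag p X U V a :
    U \is unitarymx -> V \is unitarymx -> X = U *m diag_mx a *m V ->
  schatten p X = (\sum_i normc (a 0 i) `^ p) `^ p^-1.
Proof.
move=> uU uV XE.
by rewrite /schatten (sum_singular_values_diag (fun s => s `^ p) uU uV XE).
Qed.

(** In the singular bases of [A + B] the diagonal of [A + B] consists of its
    singular values, while the diagonals of [A] and [B] are bounded by
    [diag_le_singular_values]; the inequality of Minkowski for sums links the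
    two. *)
Lemma schattenD p A B : 1 <= p ->
  schatten p (A + B) <= schatten p A + schatten p B.
Proof.
move=> p1; have p0 : 0 < p := lt_le_trans ltr01 p1.
have mono z t q : 0 <= q -> 0 <= z -> z <= t -> z `^ q <= t `^ q.
  by move=> q0 z0 zt; apply: ge0_ler_powR; rewrite ?nnegrE // (le_trans z0).
have [U [V [uU uV E]]] := svd (A + B); set a := \row_i _ in E.
rewrite (schatten_diag p uU uV E).
pose x i := (U^t* *m A *m V^t*) i i; pose y i := (U^t* *m B *m V^t*) i i.
have aE i : a 0 i = x i + y i.
  have -> : x i + y i = (U^t* *m (A + B) *m V^t*) i i.
    by rewrite mulmxDr mulmxDl mxE.
  by rewrite E (unitary_cancel _ uU uV) [RHS]mxE eqxx.
have sum_ge0 (z : 'I_d -> R) : 0 <= \sum_i z i `^ p.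
  by apply: sumr_ge0 => i _; apply: powR_ge0.
have ip0 : 0 <= p^-1 by rewrite invr_ge0 ltW.
have uU' : U^t* \is unitarymx := unitary_trmxC uU.
have uV' : V^t* \is unitarymx := unitary_trmxC uV.
apply: (@le_trans _ _ ((\sum_i (normc (x i) + normc (y i)) `^ p) `^ p^-1)).
  apply: (mono) => //; apply: ler_sum => i _.
  apply: (mono); rewrite ?normc_ge0 ?(ltW p0) //.
  by rewrite aE le_normcD.
apply: le_trans (minkowski_sum p1 _ _) _ => [i|i|]; rewrite ?normc_ge0 //.
apply: lerD; apply: (mono) => //;
  exact: (diag_le_singular_values _ p1 uU' uV').
Qed.

Lemma schatten_unitarily_invariant_norm p :
  1 <= p -> unitarily_invariant_norm (@schatten R d p).
Proof.
move=> p1; have p0 : 0 < p := lt_le_trans ltr01 p1.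
split.
- by move=> A; apply: powR_ge0.
- move=> A; have [U [V [uU uV E]]] := svd A; rewrite (schatten_diag p uU uV E).
  move/powR_eq0_eq0/eqP; rewrite [in A = 0]E.
  rewrite psumr_eq0 => [/allP /= a0|i _]; last exact: powR_ge0.
  set a := \row_i _ in a0 *; have -> : a = 0.
    apply/rowP => i; rewrite [RHS]mxE; apply: Normc.eq0_normc.
    by have /eqP/powR_eq0_eq0 := a0 i (mem_index_enum i).
  by rewrite linear0 mulmx0 mul0mx.
- move=> c A; have [U [V [uU uV E]]] := svd A.
  rewrite (schatten_diag p uU uV E); set a := \row_i _ in E *.
  have cE : c *: A = U *m diag_mx (c *: a) *m V.
    by rewrite linearZ /= -scalemxAr -scalemxAl -E.
  rewrite (schatten_diag p uU uV cE).
  under eq_bigr do rewrite mxE Normc.normcM powRM ?normc_ge0 //.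
  rewrite -mulr_sumr powRM ?powR_ge0 //; last first.
    by apply: sumr_ge0 => i _; apply: powR_ge0.
  by rewrite -powRrM mulfV ?powRr1 ?normc_ge0 // gt_eqF.
- by move=> A B; apply: schattenD.
- move=> U A V uU uV; have [W [Z [uW uZ E]]] := svd A.
  rewrite (schatten_diag p uW uZ E).
  apply: (schatten_diag p (mul_unitarymx uU uW) (mul_unitarymx uZ uV)).
  by rewrite {1}E !mulmxA.
Qed.

Lemma schatten_pid2 p : (2 <= d)%N -> 1 <= p ->
  schatten p (pid_mx 2 : 'M[C]_d) = 2 `^ p^-1.
Proof.
move=> d2 p1; have p0 : 0 < p := lt_le_trans ltr01 p1.
pose e : 'rV[C]_d := \row_i (i < 2)%:R.
have E : pid_mx 2 = 1%:M *m diag_mx e *m 1%:M.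
  rewrite mul1mx mulmx1; apply/matrixP => i j; rewrite !mxE.
  by rewrite -val_eqE; case: eqP.
rewrite (schatten_diag p (unitarymx1 d) (unitarymx1 d) E); congr (_ `^ _).
transitivity (\sum_(i < d) (i < 2)%:R : R).
  apply: eq_bigr => i _; rewrite mxE.
  rewrite -[_%:R](rmorph_nat (real_complex R)) normc_real ?ler0n //.
  by case: (i < 2)%N; rewrite ?powR1 // powR0 // gt_eqF.
by case: d d2 => [|[|n]] // _; rewrite !big_ord_recl big1 ?addr0.
Qed.

End SchattenNorm.

(** * Variance *)

Section Variance.
Context {C : numClosedFieldType}.

(** The variance is unchanged by translation. Translating by the mean kills the
    second term and shows that the variance is nonnegative; translating by the
    centre of a disc containing the [z i] bounds it by the squared radius. *)
Lemma variance_shift (I : finType) (p z : I -> C) (y : C) :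
    (forall i, 0 <= p i) -> \sum_i p i = 1 ->
  \sum_i p i * `|z i| ^+ 2 - `|\sum_i p i * z i| ^+ 2 =
  \sum_i p i * `|z i - y| ^+ 2 - `|\sum_i p i * z i - y| ^+ 2.
Proof.
move=> p0 p1; set m := \sum_i p i * z i.
have mJ : m^* = \sum_i p i * (z i)^*.
  rewrite rmorph_sum; apply: eq_bigr => i _; rewrite rmorphM; congr (_ * _).
  by apply/CrealP/ger0_real.
have sqrB (u v : C) : `|u - v| ^+ 2 = `|u| ^+ 2 - u * v^* - u^* * v + `|v| ^+ 2.
  by rewrite !normCK rmorphB; ring.
have -> : \sum_i p i * `|z i - y| ^+ 2 =
    \sum_i p i * `|z i| ^+ 2 - m * y^* - m^* * y + `|y| ^+ 2.
  rewrite mJ /m !mulr_suml -!sumrB -[in RHS](mul1r (`|y| ^+ 2)) -p1 mulr_suml.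
  by rewrite -big_split; apply: eq_bigr => i _; rewrite sqrB /=; ring.
by rewrite sqrB; ring.
Qed.

Lemma trace_mul_unitary_diag n (rho P : 'M[C]_n) (v : 'rV[C]_n) :
  \tr (rho *m (P^t* *m diag_mx v *m P)) = \sum_i (P *m rho *m P^t*) i i * v 0 i.
Proof.
rewrite mulmxA mxtrace_mulC !mulmxA mul_mx_diag /mxtrace.
by apply: eq_bigr => i _; rewrite [LHS]mxE.
Qed.

Lemma conj_diag_entry n (rho P : 'M[C]_n) i :
  (P *m rho *m P^t*) i i = (row i P *m rho *m (row i P)^t*) 0 0.
Proof. by rewrite -row_mul !mxE; apply: eq_bigr => k _; rewrite !mxE. Qed.

Lemma square_conj_diag n (P : 'M[C]_n) (a : 'rV[C]_n) : P \in unitmx ->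
  (invmx P *m diag_mx a *m P) *m (invmx P *m diag_mx a *m P) =
  invmx P *m diag_mx (\row_i (a 0 i) ^+ 2) *m P.
Proof.
move=> uP; rewrite !mulmxA mulmxK // -[_ *m diag_mx a *m diag_mx a]mulmxA.
by rewrite mulmx_diag.
Qed.

Lemma spectral_sqrt_square n (A : 'M[C]_n) (P := spectralmx A) : A \is normalmx ->
  let S := invmx P *m diag_mx (map_mx sqrtC (spectral_diag A)) *m P in
  S *m S = A.
Proof.
move=> /orthomx_spectralP E /=; rewrite square_conj_diag ?spectral_unit // [RHS]E.
by congr (_ *m diag_mx _ *m _); apply/rowP => i; rewrite !mxE sqrtCK.
Qed.

Lemma eigenvalue_unitary_diag n (P : 'M[C]_n) (v : 'rV[C]_n) a :
    P \is unitarymx ->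
  eigenvalue (P^t* *m diag_mx v *m P) a = (a \in [seq v 0 i | i <- enum 'I_n]).
Proof.
move=> uP; rewrite eigenvalue_root_char -invmx_unitary //.
rewrite char_poly_conj ?unitarymx_unit // char_poly_diag.
by rewrite -root_prod_XsubC big_map big_enum.
Qed.

End Variance.

(** * The radius of a normal matrix *)

Section Radius.
Context {R : realType} {d : nat}.
Local Notation C := R[i].
Local Notation normc := (@Normc.normc R).
Context (X P : 'M[C]_d) (v : 'rV[C]_d).
Context (uP : P \is unitarymx) (XE : X = P^t* *m diag_mx v *m P).

Lemma eigenvalueE : [set a : C | eigenvalue X a] = [set v 0 i | i in [set: 'I_d]].
Proof.
apply/seteqP; split => a /=; rewrite XE (eigenvalue_unitary_diag _ _ uP).
  by case/mapP=> i _ ->; exists i.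
by case=> i _ <-; rewrite map_f ?mem_enum.
Qed.

Let spread y := sup [set normc (a - y) | a in [set a : C | eigenvalue X a]].

Lemma normc_le_spread y i : normc (v 0 i - y) <= spread y.
Proof.
apply: ub_le_sup; last by exists (v 0 i) => //; rewrite eigenvalueE; exists i.
(* Any upper bound does: the sum of the distances is one. *)
exists (\sum_j normc (v 0 j - y)) => _ [a + <-]; rewrite eigenvalueE => -[j _ <-].
by rewrite (bigD1 j) //= lerDl; apply: sumr_ge0 => k _; apply: normc_ge0.
Qed.

Lemma le_mxradius m :
    (forall y M, (forall i, normc (v 0 i - y) <= M) -> m <= M) ->
  m <= mxradius X.
Proof.
move=> mM; apply: lb_le_inf; first by exists (spread 0); exists 0.
by move=> _ [y _ <-]; apply: (mM y); apply: normc_le_spread.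
Qed.

Lemma mxradius_le y M : (0 < d)%N -> (forall i, normc (v 0 i - y) <= M) ->
  mxradius X <= M.
Proof.
move=> d0 yM; pose i0 := Ordinal d0.
apply: (@le_trans _ _ (spread y)).
  apply: ge_inf; last by exists y.
  exists 0 => _ [z _ <-]; apply: le_trans (normc_le_spread z i0).
  exact: normc_ge0.
apply: ge_sup.
  exists (normc (v 0 i0 - y)); exists (v 0 i0) => //.
  by rewrite eigenvalueE; exists i0.
by move=> _ [a + <-]; rewrite eigenvalueE => -[j _ <-].
Qed.

End Radius.

(** * Variance, radius and second Ky Fan norm *)

Section Bounds.
Context {R : realType} {d : nat}.
Local Notation C := R[i].
Local Notation normc := (@Normc.normc R).
Implicit Types (X rho : 'M[C]_d).

Lemma absmx_square X : absmx X *m absmx X = X^t* *m X.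
Proof.
exact: spectral_sqrt_square (normalmx_gram X).
Qed.

Lemma qvar_unitary_diag rho X P (v : 'rV[C]_d) : P \is unitarymx ->
    X = P^t* *m diag_mx v *m P -> let p i := (P *m rho *m P^t*) i i in
  qvar rho X = \sum_i p i * `|v 0 i| ^+ 2 - `|\sum_i p i * v 0 i| ^+ 2.
Proof.
move=> uP XE p; rewrite /qvar absmx_square.
have -> : X^t* *m X = P^t* *m diag_mx (\row_i ((v 0 i)^* * v 0 i)) *m P.
  by rewrite XE; apply: gram_diag (unitary_trmxC uP).
have -> : \tr (rho *m X) = \sum_i p i * v 0 i.
  by rewrite XE; apply: trace_mul_unitary_diag.
congr (_ - _); apply: etrans (trace_mul_unitary_diag _ _ _) _.
by apply: eq_bigr => i _; congr (_ * _); rewrite mxE normCKC.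
Qed.

(** In an eigenbasis of [X] the diagonal of [rho] is a probability vector, and
    [qvar rho X] is the variance of the eigenvalues under it. *)
Lemma sqrt_qvar_le_mxradius X rho : (0 < d)%N -> X \is normalmx ->
  density_matrix rho -> sqrtC (qvar rho X) <= (mxradius X)%:C.
Proof.
move=> d0 /normal_diagonalization[P uP XE] [[_ rho_ge0] tr_rho].
set v := spectral_diag X in XE.
pose p i := (P *m rho *m P^t*) i i.
have p_ge0 i : 0 <= p i.
  by rewrite /p conj_diag_entry -{1}[row i P]trmxCK; apply: rho_ge0.
have p_sum : \sum_i p i = 1.
  rewrite -tr_rho -[RHS]/(\tr rho) -[\sum_i p i]/(\tr (P *m rho *m P^t*)).
  by rewrite mxtrace_mulC mulmxA unitary_mulmxVt // mul1mx.
have varE := variance_shift (v 0) _ p_ge0 p_sum.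
have q_ge0 : 0 <= qvar rho X.
  rewrite (qvar_unitary_diag rho uP XE) (varE (\sum_i p i * v 0 i)).
  rewrite subrr normr0 expr0n subr0.
  by apply: sumr_ge0 => i _; rewrite mulr_ge0 ?exprn_ge0.
have [q q0 qE] : exists2 q : R, 0 <= q & qvar rho X = q%:C.
  have := q_ge0; case: (qvar rho X) => x y; rewrite lecE /= => /andP[/eqP -> x0].
  by exists x.
have -> : sqrtC (qvar rho X) = (Num.sqrt q)%:C.
  by rewrite qE -{1}[q]sqr_sqrtr // rmorphXn sqrCK // ler0c sqrtr_ge0.
rewrite lecR; apply: (le_mxradius uP XE) => y M yM.
have M0 : 0 <= M := le_trans (normc_ge0 _) (yM (Ordinal d0)).
rewrite -[M]ger0_norm // -sqrtr_sqr ler_wsqrtr // -lecR -qE.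
rewrite (qvar_unitary_diag rho uP XE) (varE y).
apply: (@le_trans _ _ (\sum_i p i * `|v 0 i - y| ^+ 2)).
  by rewrite gerBl exprn_ge0.
apply: (@le_trans _ _ (\sum_i p i * (M ^+ 2)%:C)); last first.
  by rewrite -mulr_suml p_sum mul1r.
apply: ler_sum => i _; rewrite ler_wpM2l // norm_normc -rmorphXn lecR.
by rewrite ler_sqr ?nnegrE ?normc_ge0.
Qed.

Lemma singular_values_sorted X i j : (i <= j)%N ->
  (singular_values X)`_j <= (singular_values X)`_i.
Proof.
move=> ij; have [lt_j|le_j] := ltnP j (size (singular_values X)); last first.
  by rewrite [X in X <= _]nth_default // singular_value_ge0.
have ge_trans : transitive (>=%R : rel R).
  by move=> y x z /= yx zy; apply: le_trans zy yx.
apply: (sorted_leq_nth ge_trans (fun x => lexx x)) => //;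
  rewrite ?inE ?(leq_ltn_trans ij) //.
by apply: sort_sorted => x y; apply: le_total.
Qed.

(** Let [lambda] be an eigenvalue of largest modulus [s0]; all the others lie
    in the disc of radius [s1] around the origin. The disc of radius
    [(s0 + s1) / 2] centred at distance [(s0 - s1) / 2] from the origin, in the
    direction of [lambda], contains both that disc and [lambda]. *)
Lemma mxradius_le_kyfan2 X : (1 < d)%N -> X \is normalmx ->
  mxradius X <= 2^-1 * kyfan2 X.
Proof.
move=> d1 /normal_diagonalization[P uP XE]; set v := spectral_diag X in XE.
have d0 : (0 < d)%N := ltnW d1.
have [t tE] := sort_enumP (fun i => normc (v 0 i)).
rewrite -(singular_values_diag (unitary_trmxC uP) uP XE) in tE.
rewrite /kyfan2; set s0 := _`_0; set s1 := _`_1.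
have s10 : s1 <= s0 by apply: singular_values_sorted.
have s1_ge0 : 0 <= s1 by apply: singular_value_ge0.
pose i0 := t (Ordinal d0).
have v0 : normc (v 0 i0) = s0 by rewrite -tE.
have vi i : i != i0 -> normc (v 0 i) <= s1.
  move=> ni; have iE : i = t (t^-1%g i) by rewrite permKV.
  rewrite iE -tE; apply: singular_values_sorted; rewrite lt0n.
  apply: contraNneq ni => k0; rewrite iE; apply/eqP.
  by congr (t _); apply/val_inj.
(* For s0 = 0 the totality of division gives c = 0, the right centre. *)
pose c := (s0 - s1) / (2 * s0).
have c0 : 0 <= c by rewrite divr_ge0 ?subr_ge0 // mulr_ge0 // (le_trans s1_ge0).
have cs0 : c * s0 = (s0 - s1) / 2.
  rewrite /c; have [s00|s00] := eqVneq s0 0; last by field.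
  have -> : s1 = 0 by apply/eqP; rewrite eq_le s1_ge0 -s00 s10.
  by rewrite s00 mulr0 subrr mul0r.
have c1 : c <= 1.
  have [s00|s00] := eqVneq s0 0; first by rewrite /c s00 mulr0 invr0 mulr0.
  have s0_gt0 : 0 < s0 by rewrite lt_def s00 (le_trans s1_ge0).
  by rewrite ler_pdivrMr; lra.
apply: (mxradius_le uP XE (y := c%:C * v 0 i0)) => // i.
have [->|/vi le_vi] := eqVneq i i0.
  rewrite -[X in X - _]mul1r -mulrBl -(rmorph1 (real_complex R)) -rmorphB.
  rewrite Normc.normcM v0.
  by rewrite normc_real ?subr_ge0 // mulrBl cs0; lra.
apply: le_trans (le_normcD _ _) _; rewrite normcN Normc.normcM normc_real // v0 cs0.
lra.
Qed.

End Bounds.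

(** * Unitarily invariant norms *)

Section UnitarilyInvariant.
Context {R : realType} {d : nat}.
Local Notation C := R[i].
Context (N : 'M[C]_d -> R) (hN : unitarily_invariant_norm N).
Implicit Types (v : 'rV[C]_d).

Lemma uinorm_perm v (t : 'S_d) : N (diag_mx (\row_i v 0 (t i))) = N (diag_mx v).
Proof. by rewrite diag_mx_perm (uinorm_unitary hN) // perm_mx_unitary. Qed.

Lemma uinorm_phase v (e : 'rV[C]_d) : (forall i, `|e 0 i| = 1) ->
  N (diag_mx (\row_i (e 0 i * v 0 i))) = N (diag_mx v).
Proof.
move=> e1; rewrite -mulmx_diag -[X in N X]mulmx1.
exact: (uinorm_unitary hN _ (diag_mx_unitary e1) (unitarymx1 d)).
Qed.

Lemma uinorm_pid2_gt0 : (1 < d)%N -> 0 < N (pid_mx 2).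
Proof.
move=> d1; rewrite lt_def (uinorm_ge0 hN) andbT; apply/eqP => /(uinorm_eq0 hN).
move/matrixP/(_ (Ordinal (ltnW d1)) (Ordinal (ltnW d1))); rewrite !mxE /= => /eqP.
by rewrite oner_eq0.
Qed.

(** By the singular value decomposition [X] may be taken diagonal. Flipping the
    signs of all entries but the first two, and exchanging the first two, are
    unitary operations on it; the average of the four resulting diagonal
    matrices keeps only the first two entries, both replaced by their mean, so
    it is a multiple of [pid_mx 2]. *)
Lemma kyfan2_le_uinorm X : (1 < d)%N ->
  2^-1 * kyfan2 X <= N X / N (pid_mx 2).
Proof.
move=> d1; rewrite ler_pdivlMr ?uinorm_pid2_gt0 //.
have [U [V [uU uV XE]]] := svd X; set v := \row_i _ in XE.
have NX : N X = N (diag_mx v) by rewrite {1}XE; exact: uinorm_unitary hN _ _ _ uU uV.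
pose i0 : 'I_d := Ordinal (ltnW d1); pose i1 : 'I_d := Ordinal d1.
pose e : 'rV[C]_d := \row_i if (i < 2)%N then 1 else -1.
pose w : 'rV[C]_d := \row_i (e 0 i * v 0 i).
pose t := tperm i0 i1.
pose swap (u : 'rV[C]_d) : 'rV[C]_d := \row_i u 0 (t i).
have avg : (2^-1 * kyfan2 X)%:C *: pid_mx 2 =
    (4^-1)%:C *: (diag_mx v + diag_mx w + diag_mx (swap v) + diag_mx (swap w)).
  have cast : (2^-1 * kyfan2 X)%:C = 2^-1 * (v 0 i0 + v 0 i1).
    by rewrite !mxE /= rmorphM fmorphV rmorph_nat rmorphD.
  have cast4 : (4^-1)%:C = 4^-1 :> C by rewrite fmorphV rmorph_nat.
  have i01 : i1 != i0 by [].
  rewrite cast cast4; apply/matrixP => i j.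
  rewrite !mxE -val_eqE; case: (val i == val j);
    rewrite ?mulr0n ?andbF ?addr0 ?mulr0 //.
  rewrite !mulr1n.
  have [->|ni0] := eqVneq i i0; first by rewrite tpermL /=; field.
  have [->|ni1] := eqVneq i i1; first by rewrite tpermR /=; field.
  have i2 : (i < 2)%N = false.
    by case: i ni0 ni1 => [[|[|m]] ?].
  by rewrite tpermD 1?eq_sym // i2 /=; ring.
have k0 : 0 <= 2^-1 * kyfan2 X 
  by rewrite /kyfan2 mulr_ge0 ?invr_ge0 ?addr_ge0 ?singular_value_ge0.
have i4 : 0 <= 4^-1 :> R by rewrite invr_ge0.
rewrite -{1}(normc_real k0) -(uinormZ hN) avg (uinormZ hN) (normc_real i4) NX.
have Nw : N (diag_mx w) = N (diag_mx v).
  by apply: uinorm_phase => i; rewrite mxE; case: ifP; rewrite ?normrN normr1.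
have four : N (diag_mx v + diag_mx w + diag_mx (swap v) + diag_mx (swap w))
    <= N (diag_mx v) + N (diag_mx v) + N (diag_mx v) + N (diag_mx v).
  do 2 (apply: le_trans (uinormD hN _ _) _; rewrite uinorm_perm ?Nw lerD2r).
  by apply: le_trans (uinormD hN _ _) _; rewrite Nw.
lra.
Qed.

End UnitarilyInvariant.

Theorem theorem8 (R : realType) (d : nat) (hd : (2 <= d)%N)
    (X rho : 'M[R[i]]_d) (N : 'M[R[i]]_d -> R) (hX : X \is normalmx)
    (hrho : density_matrix rho) (hN : unitarily_invariant_norm N) :
  [/\ sqrtC (qvar rho X) <= (mxradius X)%:C,
      mxradius X <= 2^-1 * kyfan2 X,
      2^-1 * kyfan2 X <= N X / N (pid_mx 2)
    & forall p : R, 1 <= p ->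
        unitarily_invariant_norm (@schatten R d p) /\
        schatten p X / schatten p (pid_mx 2 : 'M[R[i]]_d)
          = 2 `^ (- p^-1) * schatten p X].
Proof.
split.
- exact: sqrt_qvar_le_mxradius (ltnW hd) hX hrho.
- exact: mxradius_le_kyfan2 hd hX.
- exact: kyfan2_le_uinorm hN X hd.
- move=> p p1; split; first exact: schatten_unitarily_invariant_norm.
  by rewrite schatten_pid2 // powRN mulrC.
Qed.
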